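(* Let $\mathcal N$ be a finite, locally irreducible, strongly connected and critical abelian network with period vector $\mathbf r$, and let $\mathbf q,\mathbf q'\in\mathrm{Loc}(\mathcal N)$. Then for any legal execution $w$ that sends $\mathbf x.\mathbf q$ to $\mathbf x'.\mathbf q'$ (where $\mathbf x,\mathbf x'\in\mathbb Z^A$), $$-\frac{\|\mathbf c\|}{\|\mathbf r\|}\mathbf r(a)-\mathbf r(a)<|w|(a)-\frac{\ell}{\|\mathbf r\|}\mathbf r(a)<\mathbf r(a)+\mathbf c(a)\qquad\text{for all }a\in A,$$ where $\ell$ is the length of $w$ and $\mathbf c\in\mathbb R^A$ is given by $$\mathbf c(a)=\max_{z\in A}\left(\mathbf v_{a,z}^\top(\mathbf x-\mathbf x')+\mathrm{diff}_{a,z}(\mathbf q',\mathbf q)\right).$$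
   Context: Abelian networks. $\mathbb N=\{0,1,2,\dots\}$. Let $G=(V,E)$ be a finite directed graph (self-loops and multiple edges allowed). An abelian network $\mathcal N$ on $G$ assigns to each $v\in V$ a nonempty input alphabet $A_v$ and a nonempty state space $Q_v$ (the $A_v$ pairwise disjoint), maps $T_a:Q_v\to Q_v$ for $a\in A_v$, and, for each edge $e$ from $v$ to $u$, a message-passing function $T_e:Q_v\times A_v\to A_u^*$ (free monoid of words), such that for all $v$, $a,b\in A_v$, $q\in Q_v$: $T_aT_b=T_bT_a$, and for every edge $e$ out of $v$ the words $T_e(q,a)T_e(T_a(q),b)$ and $T_e(q,b)T_e(T_b(q),a)$ agree up to permuting letters. Put $A=\bigsqcup_v A_v$, $Q=\prod_v Q_v$; $\mathcal N$ is finite if $A$ and $Q$ are finite. For a word $w\in A^*$, $|w|\in\mathbb N^A$ counts the occurrences of each letter. For $a\in A_v$, $\mathbf q\in Q$: $t_a\mathbf q$ is $\mathbf q$ with $\mathbf q(v)$ replaced by $T_a(\mathbf q(v))$, and $\mathbf M_a(\mathbf q)=\sum_{e\text{ out of }v}|T_e(\mathbf q(v),a)|\in\mathbb N^A$. A configuration is a pair $\mathbf x.\mathbf q$ with $\mathbf x\in\mathbb Z^A$, $\mathbf q\in Q$; $\pi_a(\mathbf x.\mathbf q)=(\mathbf x+\mathbf M_a(\mathbf q)-|a|).t_a\mathbf q$. For $w=a_1\cdots a_\ell$: $t_w=t_{a_\ell}\cdots t_{a_1}$, $\mathbf M_w(\mathbf q)=\sum_i\mathbf M_{a_i}(t_{a_1\cdots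 a_{i-1}}\mathbf q)$, $\pi_w=\pi_{a_\ell}\cdots\pi_{a_1}$; these depend only on $|w|$, so $t_{\mathbf n},\mathbf M_{\mathbf n},\pi_{\mathbf n}$ are defined for $\mathbf n\in\mathbb N^A$. The word $w$ is a legal execution for $\mathbf x.\mathbf q$ if, with $\mathbf x_i.\mathbf q_i=\pi_{a_1\cdots a_i}(\mathbf x.\mathbf q)$, $\mathbf x_{i-1}(a_i)\ge1$ for all $1\le i\le\ell$; it sends $\mathbf x.\mathbf q$ to $\pi_w(\mathbf x.\mathbf q)$. Local recurrence, kernel, production matrix. $\mathcal N$ is locally irreducible if for all $\mathbf q,\mathbf q'\in Q$ there are words $w,w'$ with $t_w\mathbf q=t_{w'}\mathbf q'$. For $\mathcal N$ finite, let $e$ be the product of all idempotents of the finite commutative monoid generated by the $t_a$ in $\mathrm{End}(Q)$; $\mathrm{Loc}(\mathcal N)=eQ$ is the set of locally recurrent states. The total kernel is $K=\{\mathbf z\in\mathbb Z^A: t_{\mathbf z^+}\mathbf q=t_{\mathbf z^-}\mathbf q\ \forall\mathbf q\in\mathrm{Loc}(\mathcal N)\}$, with $\mathbf z^{\pm}\in\mathbb N^A$ the positive/negative parts of $\mathbf z$; it is a finite-index subgroup of $\mathbb Z^A$. For $\mathcal N$ finite and locally irreducible, the production matrix $P$ is the unique rational $A\times A$ matrix with $P\mathbf k=\mathbf M_{\mathbf k}(\mathbf q)$ for all $\mathbf k\in K\cap\mathbb N^A$ and $\mathbf q\in\mathrm{Loc}(\mathcal N)$. $\mathcal N$ is critical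 if the spectral radius of $P$ is $1$, and strongly connected if the digraph on $A$ with an edge $(a,b)$ whenever $P_{ba}>0$ is strongly connected. Further notation. The period vector $\mathbf r$ is the unique positive integer vector generating the group $\{\mathbf k\in K:P\mathbf k=\mathbf k\}$. The exchange rate vector $\mathbf s$ is the unique positive integer vector with $\mathbf s^\top P=\mathbf s^\top$ and $\gcd_a\mathbf s(a)=1$. $\|\mathbf n\|=\sum_{a\in A}\mathbf n(a)$. The matrix $p(a,b)=\frac{\mathbf s(b)}{\mathbf s(a)}P(b,a)$ is the transition matrix of a Markov chain on $A$. For $a,b,z\in A$, $\mathfrak G_z(b,a)$ is the expected number of visits to $a$ strictly before hitting $z$ by this chain started at $b$ (visits at time $0$ count, and $\mathfrak G_z(z,a)=0$). Define $\mathbf v_{a,z}\in\mathbb R^A_{\ge0}$ by $\mathbf v_{a,z}(b)=\frac{\mathbf s(b)}{\mathbf s(a)}\mathfrak G_z(b,a)$ (so $\mathbf v_{a,a}=\mathbf 0$). For $\mathbf p,\mathbf p'\in\mathrm{Loc}(\mathcal N)$, $\mathrm{diff}_{a,z}(\mathbf p,\mathbf p')=\mathbf v_{a,z}^\top(P|u|-\mathbf M_u(\mathbf p))$, where $u$ is any (not necessarily legal) word with $t_u\mathbf p=\mathbf p'$ (such $u$ exists and the value does not depend on the choice of $u$). *)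

(* Defs.v *)
From HB Require Import structures.
From mathcomp Require Import all_boot all_order all_algebra all_field.
From mathcomp Require Import all_classical all_reals all_analysis.
From mathcomp Require Import lra.

Set Implicit Arguments.
Unset Strict Implicit.
Unset Printing Implicit Defensive.

Import Order.TTheory GRing.Theory Num.Theory.
Local Open Scope classical_set_scope.
Local Open Scope ring_scope.

(* A finite directed multigraph, given by the edges out of each vertex; loops
   and parallel edges are allowed. *)
Record digraph := Digraph {
  vertex : finType;
  out_edge : vertex -> finType;
  target : forall v : vertex, out_edge v -> vertex }.

(* A finite abelian network on G. The alphabets are made disjoint by forming
   the tagged sum [letter]. Since V is finite and all A_v, Q_v are nonempty,
   the sum of the A_v and the product of the Q_v are finite exactly when every
   A_v and every Q_v is, so finiteness is carried by the finType structures. *)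
Record finite_abelian_network (G : digraph) := FiniteAbelianNetwork {
  alphabet : vertex G -> finType;
  state : vertex G -> finType;
  alphabet_neq0 : forall v, (0 < #|alphabet v|)%N;
  state_neq0 : forall v, (0 < #|state v|)%N;
  trans : forall v, alphabet v -> state v -> state v;
  msg : forall v (e : out_edge v),
    state v -> alphabet v -> seq (alphabet (target e));
  transC : forall v (a b : alphabet v) (q : state v),
    trans a (trans b q) = trans b (trans a q);
  msgC : forall v (e : out_edge v) (a b : alphabet v) (q : state v),
    perm_eq (msg e q a ++ msg e (trans a q) b)
            (msg e q b ++ msg e (trans b q) a) }.

Section Network.
Variables (G : digraph) (N : finite_abelian_network G).

Definition letter : finType := {v : vertex G & alphabet N v}.
Definition gstate : finType := {dffun forall v : vertex G, state N v}.

Definition wcount (w : seq letter) : {ffun letter -> nat} :=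
  [ffun a => count_mem a w].

Definition tact (a : letter) (q : gstate) : gstate :=
  finfun (eqtype.dfwith q (trans (tagged a) (q (tag a)))).

Definition message (a : letter) (q : gstate) : {ffun letter -> nat} :=
  [ffun b => (\sum_(e : out_edge (tag a))
    wcount [seq Tagged (alphabet N) c | c <- msg e (q (tag a)) (tagged a)] b)%N].

Fixpoint tact_word (w : seq letter) (q : gstate) : gstate :=
  if w is a :: w' then tact_word w' (tact a q) else q.

Fixpoint message_word (w : seq letter) (q : gstate) : {ffun letter -> nat} :=
  [ffun b => if w is a :: w'
             then (message a q b + message_word w' (tact a q) b)%N else 0%N].

(* t_n and M_n depend only on the letter counts; a word with counts n is fixed. *)
Definition word_of (n : {ffun letter -> nat}) : seq letter :=
  flatten [seq nseq (n a) a | a <- enum letter].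
Definition tact_vec (n : {ffun letter -> nat}) := tact_word (word_of n).
Definition message_vec (n : {ffun letter -> nat}) := message_word (word_of n).

Definition configuration : Type := ({ffun letter -> int} * gstate)%type.

Definition fire (a : letter) (c : configuration) : configuration :=
  ([ffun b => c.1 b + (message a c.2 b)%:Z - (b == a)%:Z], tact a c.2).

Fixpoint fire_word (w : seq letter) (c : configuration) : configuration :=
  if w is a :: w' then fire_word w' (fire a c) else c.

Fixpoint legal (w : seq letter) (c : configuration) : bool :=
  if w is a :: w' then (1 <= c.1 a) && legal w' (fire a c) else true.

Definition locally_irreducible : Prop :=
  forall q q' : gstate, exists w w' : seq letter, tact_word w q = tact_word w' q'.

Definition monoid_idempotent (f : {ffun gstate -> gstate}) : Prop :=
  (exists w : seq letter, forall q, f q = tact_word w q) /\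
  (forall q, f (f q) = f q).

(* The transition monoid is commutative, so the order of the product is
   irrelevant. *)
Definition idempotent_product : gstate -> gstate :=
  \big[(fun f g : gstate -> gstate => f \o g)/idfun]_(
     f : {ffun gstate -> gstate} | `[< monoid_idempotent f >]) (f : gstate -> gstate).

Definition locally_recurrent (q : gstate) : Prop :=
  exists q0 : gstate, q = idempotent_product q0.

Definition pos_part (z : {ffun letter -> int}) : {ffun letter -> nat} :=
  [ffun a => `|Num.max (z a) 0|%N].
Definition neg_part (z : {ffun letter -> int}) : {ffun letter -> nat} :=
  [ffun a => `|Num.max (- z a) 0|%N].

Definition total_kernel (z : {ffun letter -> int}) : Prop :=
  forall q, locally_recurrent q ->
    tact_vec (pos_part z) q = tact_vec (neg_part z) q.

Definition int_of_vec (n : {ffun letter -> nat}) : {ffun letter -> int} :=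
  [ffun a => (n a)%:Z].

Definition production_matrix (P : letter -> letter -> rat) : Prop :=
  forall k : {ffun letter -> nat}, total_kernel (int_of_vec k) ->
  forall q, locally_recurrent q ->
  forall a, \sum_b P a b * (k b)%:R = (message_vec k q a)%:R.

Definition strongly_connected (P : letter -> letter -> rat) : Prop :=
  forall a b, connect (fun c d => 0 < P d c) a b.

Definition has_spectral_radius (P : letter -> letter -> rat) (rho : algC) : Prop :=
  let M := \matrix_(i < #|letter|, j < #|letter|)
             (ratr (P (enum_val i) (enum_val j)) : algC) in
  (exists2 lambda, eigenvalue M lambda & `|lambda| = rho) /\
  (forall lambda, eigenvalue M lambda -> `|lambda| <= rho).

Definition critical (P : letter -> letter -> rat) : Prop :=
  has_spectral_radius P 1.

Definition period_vector (P : letter -> letter -> rat)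
    (r : {ffun letter -> nat}) : Prop :=
  (forall a, (0 < r a)%N) /\
  (forall k : {ffun letter -> int},
    (total_kernel k /\ forall a, \sum_b P a b * (k b)%:~R = (k a)%:~R) <->
    exists n : int, forall a, k a = n * (r a)%:Z).

Definition exchange_rate_vector (P : letter -> letter -> rat)
    (s : {ffun letter -> nat}) : Prop :=
  [/\ forall a, (0 < s a)%N,
      forall b, \sum_a (s a)%:R * P a b = (s b)%:R
    & \big[gcdn/0%N]_a s a = 1%N].

End Network.

(* A time-homogeneous Markov chain with transition matrix p started at b. *)
Record markov_chain (R : realType) (A : finType) (p : A -> A -> R) (b : A) :=
  MarkovChain {
    mc_display : measure_display;
    mc_space : measurableType mc_display;
    mc_law : probability mc_space R;
    mc_proc : nat -> mc_space -> A;
    mc_measurable : forall (n : nat) (a : A),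
      measurable [set omega : mc_space | mc_proc n omega = a];
    mc_cylinder : forall (n : nat) (x : nat -> A),
      mc_law [set omega : mc_space | forall i, (i <= n)%N -> mc_proc i omega = x i] =
      ((x 0%N == b)%:R * \prod_(i < n) p (x i) (x i.+1))%:E }.

Arguments mc_proc {R A p b} m n omega.
Arguments mc_law {R A p b} m.
Arguments mc_space {R A p b} m.

(* Every stochastic matrix has a chain from every start, so quantifying over
   realizations of the chain is not vacuous. The chain is built on [0, 1] with
   the uniform law: u selects the subinterval of length p a c containing it, and
   its rescaled position there drives the following steps. *)
Section MarkovChainExists.
Variables (R : realType) (A : finType) (p : A -> A -> R) (b : A).
Hypothesis p_ge0 : forall a c, 0 <= p a c.
Hypothesis p_sum1 : forall a, \sum_c p a c = 1.

Let nthA i := nth b (enum A) i.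
Let F a k := \sum_(0 <= i < k) p a (nthA i).
Let sel a (u : R) := find (fun k => u < F a k.+1) (iota 0 #|A|).
Let lo a c := F a (index c (enum A)).
Let next (s : A * R) : A * R :=
  (nthA (sel s.1 s.2), (s.2 - F s.1 (sel s.1 s.2)) / p s.1 (nthA (sel s.1 s.2))).

Let FS a k : F a k.+1 = F a k + p a (nthA k).
Proof. by rewrite /F big_nat_recr. Qed.

Let F_mono a i j : (i <= j)%N -> F a i <= F a j.
Proof.
move=> ij; rewrite /F (big_cat_nat _ ij) //= lerDl.
by apply: sumr_ge0.
Qed.

Let F_card a : F a #|A| = 1.
Proof.
by rewrite /F -(p_sum1 a) cardE -(big_nth b xpredT (p a)) big_enum.
Qed.

Let lo_ge0 a c : 0 <= lo a c.
Proof. by apply: sumr_ge0. Qed.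

Let lo_le1 a c : lo a c + p a c <= 1.
Proof.
have ic : (index c (enum A) < #|A|)%N by rewrite cardE index_mem mem_enum.
rewrite -(F_card a) (le_trans _ (F_mono a ic)) // FS.
by rewrite /lo /nthA nth_index ?mem_enum.
Qed.

Let next_spec a c u : 0 <= u < 1 ->
  (next (a, u)).1 = c <-> lo a c <= u < lo a c + p a c.
Proof.
move=> /andP[u0 u1] /=.
have hs : has (fun k => u < F a k.+1) (iota 0 #|A|).
  have A0 : (0 < #|A|)%N by apply/card_gt0P; exists b.
  apply/hasP; exists #|A|.-1; first by rewrite mem_iota /= add0n prednK.
  by rewrite prednK // F_card.
have sA : (sel a u < #|A|)%N by move: hs; rewrite has_find size_iota.
have h1 : u < F a (sel a u).+1.
  by have := nth_find 0%N hs; rewrite nth_iota.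
have h2 : F a (sel a u) <= u.
  case E : (sel a u) => [|k]; first by rewrite /F big_geq.
  have kf : (k < find (fun k => (u < F a k.+1)%R) (iota 0 #|A|))%N.
    by rewrite -/(sel a u) E.
  have := before_find 0%N kf; rewrite nth_iota ?add0n; last first.
    by rewrite (ltn_trans _ sA) // E.
  by move/negbT; rewrite -leNgt.
split=> [<-|/andP[l1 l2]].
  have E : index (nthA (sel a u)) (enum A) = sel a u.
    by rewrite index_uniq ?enum_uniq // -cardE.
  by rewrite /lo E h2 -FS.
set j := index c (enum A) in l1 l2 *.
have nj : nthA j = c by rewrite /nthA nth_index ?mem_enum.
have {}l2 : u < F a j.+1 by rewrite FS nj.
rewrite -nj; congr nthA; apply/eqP; rewrite eqn_leq.
apply/andP; split; rewrite leqNgt; apply/negP => lt.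
  have := F_mono a lt; move: h2 l2; lra.
have := F_mono a lt; move: h1 l1; rewrite /lo -/j; lra.
Qed.

Let next_res a u : 0 <= u < 1 ->
  let c := (next (a, u)).1 in (next (a, u)).2 = (u - lo a c) / p a c.
Proof.
move=> u01 /=; congr (_ / _); congr (_ - _); rewrite /lo.
suff sA : (sel a u < #|A|)%N by rewrite index_uniq ?enum_uniq // -cardE.
case/andP: u01 => u0 u1.
suff : has (fun k => u < F a k.+1) (iota 0 #|A|) by rewrite has_find size_iota.
have A0 : (0 < #|A|)%N by apply/card_gt0P; exists b.
apply/hasP; exists #|A|.-1; first by rewrite mem_iota /= add0n prednK.
by rewrite prednK // F_card.
Qed.

Let wt a n (x : nat -> A) : R := (x 0%N == a)%:R * \prod_(i < n) p (x i) (x i.+1).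

Let wt_ge0 a n x : 0 <= wt a n x.
Proof. by rewrite mulr_ge0 // prodr_ge0. Qed.

Let cylP n : forall (x : nat -> A) a, exists2 l, 0 <= l /\ l + wt a n x <= 1 &
  forall u, 0 <= u < 1 ->
    (forall i, (i <= n)%N -> (iter i next (a, u)).1 = x i) <->
    l <= u < l + wt a n x.
Proof.
elim: n => [|n IH] x a.
  exists 0; rewrite /wt big_ord0 mulr1 add0r; first by case: eqP; split.
  move=> u u01; split=> [/(_ 0%N isT) /= <-|]; first by rewrite eqxx.
  case: eqP => [<- _ [|]//|_ /= /andP[h1 h2]]; exfalso; lra.
have [x0|x0] := eqVneq (x 0%N) a; last first.
  exists 0; rewrite /wt (negbTE x0) mul0r addr0 //.
  move=> u u01; split=> [/(_ 0%N isT) /= e|/andP[h1 h2]].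
    by rewrite e eqxx in x0.
  exfalso; lra.
pose c := x 1%N; pose x' i := x i.+1.
have E : wt a n.+1 x = p a c * wt c n x'.
  by rewrite /wt x0 eqxx mul1r eqxx mul1r big_ord_recl /= x0.
have [l' [l0 l1] H] := IH x' c.
have w0 := wt_ge0 c n x'.
rewrite E.
exists (lo a c + p a c * l').
  split; first by rewrite addr_ge0 // mulr_ge0.
  rewrite -addrA -mulrDr; apply: le_trans (lo_le1 a c).
  by rewrite lerD2l -[leRHS]mulr1 ler_wpM2l.
move=> u u01.
have S i : iter i.+1 next (a, u) = iter i next (next (a, u)) by rewrite iterSr.
have nE : next (a, u) = ((next (a, u)).1, (next (a, u)).2) by case: (next _).
have pc0 : 0 <= p a c by [].
have resP : lo a c <= u < lo a c + p a c ->
    0 < p a c /\ 0 <= (u - lo a c) / p a c < 1.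
  move=> /andP[h1 h2]; have pp : 0 < p a c by lra.
  by split=> //; rewrite ler_pdivlMr // ltr_pdivrMr // mul0r mul1r; lra.
split=> [h|/andP[h1 h2]].
  have nc : (next (a, u)).1 = c by exact: (h 1%N).
  have uI := (next_spec a c u01).1 nc; have [pp r01] := resP uI.
  have /andP[] : l' <= (u - lo a c) / p a c < l' + wt c n x'.
    apply/(H _ r01) => i ik; rewrite -[x' i]/(x i.+1) -(h i.+1) // S.
    by rewrite nE nc next_res // nc.
  rewrite ler_pdivlMr // ltr_pdivrMr // => k1 k2.
  by apply/andP; split; nra.
have uI : lo a c <= u < lo a c + p a c.
  apply/andP; split; first by apply: le_trans h1; rewrite lerDl mulr_ge0.
  apply: lt_le_trans h2 _; rewrite -addrA -mulrDr lerD2l -[leRHS]mulr1.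
  by rewrite ler_wpM2l.
have nc := (next_spec a c u01).2 uI.
have [pp r01] := resP uI.
move=> [|i] ik; first by rewrite /= x0.
rewrite S nE next_res // nc; apply: ((H _ r01).2 _ i ik).
by rewrite ler_pdivlMr // ltr_pdivrMr //; apply/andP; split; nra.
Qed.

Let Omega := g_sigma_algebraType (R.-ocitv.-measurable).
Let U01 : set Omega := `[0, 1[.
Let law : probability Omega R := uniform_prob (@ltr01 R).
Let cut (u : R) : R := if 0 <= u < 1 then u else 0.
Let proc n (u : Omega) : A := (iter n next (b, cut u)).1.

Let cut01 u : 0 <= cut u < 1.
Proof. by rewrite /cut; case: ifP => // _; rewrite lexx ltr01. Qed.

Let U01P u : U01 u <-> 0 <= u < 1.
Proof. by rewrite /U01 /= in_itv. Qed.

Let law_itv (l w : R) : 0 <= l -> 0 <= w -> l + w <= 1 ->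
  law [set` `[l, l + w[] = w%:E.
Proof.
move=> l0 w0 lw.
rewrite /law /= /uniform_prob integral_uniform_pdf setIidl; last first.
  move=> u /=; rewrite !in_itv /= => /andP[h1 h2]; apply/andP; split; lra.
under eq_integral => u.
  rewrite inE /= in_itv /= => /andP[h1 h2].
  rewrite /uniform_pdf ifT ?subr0 ?invr1; last by apply/andP; split; lra.
  over.
rewrite integral_cst //= mul1e lebesgue_measure_itv /= lte_fin.
case: ifPn; rewrite -?EFinB ?ltrDl.
  by move=> _; rewrite addrAC subrr add0r.
by rewrite -leNgt => w0'; congr EFin; lra.
Qed.

Let cyl_set n (x : nat -> A) : exists (l : R) (D : bool),
  [/\ 0 <= l, l + wt b n x <= 1 &
  [set u : Omega | forall i, (i <= n)%N -> proc i u = x i] =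
  [set` `[l, l + wt b n x[] `|` (if D then ~` U01 else set0)].
Proof.
have [l [l0 l1] H] := cylP n x b.
exists l, `[< forall i, (i <= n)%N -> (iter i next (b, 0)).1 = x i >].
split=> //; apply/seteqP; split=> u /=.
  move=> h; have [u01|u01] := boolP (0 <= u < 1).
    left; rewrite in_itv /=; apply/(H _ u01) => i /h.
    by rewrite /proc /cut u01.
  right; case: asboolP => [_ /U01P|[]]; first by rewrite (negbTE u01).
  by move=> i /h; rewrite /proc /cut (negbTE u01).
rewrite in_itv /=; case=> [h|].
  have u01 : 0 <= u < 1 by case/andP: h => h1 h2; apply/andP; split; lra.
  by move=> i ik; rewrite /proc /cut u01; exact: ((H _ u01).2 h).
case: asboolP => // h u01 i ik.
have {}u01 : ~~ (0 <= u < 1) by apply/negP => /U01P.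
by rewrite /proc /cut (negbTE u01); exact: h.
Qed.

Let mU01 : measurable U01.
Proof. exact: measurable_itv. Qed.

Let law0 : law (~` U01) = 0%E.
Proof.
rewrite probability_setC //.
have := @law_itv 0 1 (lexx _) ler01; rewrite add0r => /(_ (lexx _)) E.
by rewrite [law _]E subee.
Qed.

Let mD (D : bool) : measurable (if D then ~` U01 else set0).
Proof. by case: D => //; exact: measurableC. Qed.

Let cyl_meas n x :
  measurable [set u : Omega | forall i, (i <= n)%N -> proc i u = x i].
Proof.
have [l [D [_ _ ->]]] := cyl_set n x.
by apply: measurableU => //; exact: measurable_itv.
Qed.

Let cyl_law n x :
  law [set u : Omega | forall i, (i <= n)%N -> proc i u = x i] = (wt b n x)%:E.
Proof.
have [l [D [l0 l1 ->]]] := cyl_set n x.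
have lD : law (if D then ~` U01 else set0) = 0%E.
  by case: D => //; rewrite measure0.
rewrite measureU0 //.
exact: law_itv.
Qed.

Let proc_meas n a : measurable [set u : Omega | proc n u = a].
Proof.
have -> : [set u : Omega | proc n u = a] =
    \bigcup_(f in [set f : {ffun 'I_n.+1 -> A} | f ord_max = a])
    [set u : Omega | forall i, (i <= n)%N -> proc i u = f (inord i)].
  apply/seteqP; split=> u /=.
    move=> h; exists [ffun i : 'I_n.+1 => proc i u]; rewrite /= ?ffunE //.
    by move=> i ik; rewrite ffunE inordK.
  case=> f /= fa /(_ n (leqnn n)) ->; rewrite -fa; congr (f _).
  by apply/val_inj; rewrite /= inordK.
apply: fin_bigcup_measurable; first exact: finite_finset.
by move=> f _; exact: (cyl_meas n (fun i => f (inord i))).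
Qed.

Lemma markov_chain_exists : inhabited (markov_chain p b).
Proof. exact: (inhabits (MarkovChain proc_meas cyl_law)). Qed.

End MarkovChainExists.

Section Green.
Variables (R : realType) (A : finType) (p : A -> A -> R).
Variable (X : forall b : A, markov_chain p b).

(* Time n is strictly before hitting z iff z is avoided at all times m <= n. *)
Definition visits_before (z a b : A) (omega : mc_space (X b)) : \bar R :=
  (\sum_(0 <= n <oo)
    (`[< mc_proc (X b) n omega = a /\
         forall m, (m <= n)%N -> mc_proc (X b) m omega <> z >]%:R : R)%:E)%E.

Definition green (z b a : A) : R :=
  fine (\int[mc_law (X b)]_omega visits_before z a omega)%E.

End Green.

Section Potential.
Variables (R : realType) (G : digraph) (N : finite_abelian_network G).
Variables (P : letter N -> letter N -> rat) (s : {ffun letter N -> nat}).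

Definition chain_matrix (a b : letter N) : R :=
  (s b)%:R / (s a)%:R * ratr (P b a).

Variable (X : forall b : letter N, markov_chain chain_matrix b).

Definition vpot (a z b : letter N) : R := (s b)%:R / (s a)%:R * green X z b a.

(* diff_{a,z}(p, t_u p), computed from a word u leading from p to t_u p. *)
Definition diff (a z : letter N) (p : gstate N) (u : seq (letter N)) : R :=
  \sum_b vpot a z b *
    (\sum_d ratr (P b d) * (wcount u d)%:R - (message_word u p b)%:R).

(* The maximum over z runs over a set containing a; the value at z = a is used
   as the starting value of the iterated maximum. *)
Definition cbound (x x' : {ffun letter N -> int}) (q' : gstate N)
    (u : seq (letter N)) (a : letter N) : R :=
  let F z := \sum_b vpot a z b * (x b - x' b)%:~R + diff a z q' u in
  \big[Num.max/F a]_z F z.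

End Potential.

(* Main.v *)
Require Import Defs.
From HB Require Import structures.
From mathcomp Require Import all_boot all_order all_algebra all_field.
From mathcomp Require Import all_classical all_reals all_analysis.
From mathcomp Require Import measurable_realfun ring lra.
Import Order.TTheory GRing.Theory Num.Theory.
Import numFieldNormedType.Exports.
Local Open Scope ring_scope.
Set Implicit Arguments.
Unset Strict Implicit.
Unset Printing Implicit Defensive.

(* Write n = |w|. Since wu fixes the locally recurrent state q, the vector
   n + |u| lies in K, so P(n + |u|) = M_{wu}(q), i.e.
   (I - P) n = (x - x') + (P|u| - M_u(q')).
   First-step analysis shows that v_{a,z}^T (I - P) is the indicator of a off z,
   and applying it to r, which I - P kills, gives its entry -r(a)/r(z) at z.
   Hence the quantity maximized in c(a) equals n(a) - r(a) n(z)/r(z), and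
   n = m r + c with m = min_z n(z)/r(z) and c >= 0. The bounds follow from
   l = m ||r|| + ||c||. *)

(** By pigeonhole two iterates of [f] coincide, so the sequence of iterates is eventually periodic;
    a multiple of the period beyond the preperiod is idempotent. *)
Lemma exists_idempotent_iter (T : finType) (f : T -> T) :
  exists2 m, (0 < m)%N & forall x, iter m f (iter m f x) = iter m f x.
Proof.
pose g (i : 'I_(#|{ffun T -> T}|).+1) : {ffun T -> T} := [ffun x => iter i f x].
have /injectivePn [i [j nij gij]] : ~~ injectiveb g.
  by apply/negP => /injectiveP /leq_card; rewrite card_ord ltnn.
wlog ltij : i j nij gij / (i < j)%N.
  move=> H; have [lt|gt|e] := ltngtP i j; first exact: H nij gij lt.
    by apply: (H j i); rewrite // eq_sym.
  by move: nij; rewrite (ord_inj e) eqxx.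
have per d x : iter (i + d * (j - i)) f x = iter i f x.
  elim: d => [|d IH]; first by rewrite mul0n addn0.
  rewrite mulSn addnA subnKC 1?ltnW // addnC iterD.
  by move/ffunP/(_ x): gij; rewrite !ffunE => <-; rewrite -iterD addnC.
have ji : (0 < j - i)%N by rewrite subn_gt0.
(* This multiple of the period [j - i] is at least [i]; the factor [i.+1] instead of [i] keeps it
   positive when [i = 0]. *)
exists (i.+1 * (j - i))%N; first by rewrite muln_gt0 ji.
move=> x; have le : (i <= i.+1 * (j - i))%N.
  by rewrite (leq_trans (leqnSn i)) // leq_pmulr.
by rewrite -iterD -{1}(subnK le) -addnA iterD per -iterD subnK.
Qed.

(** * The abelian property: words act and emit messages through their letter counts *)

Section Words.
Variables (G : digraph) (N : finite_abelian_network G).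
Implicit Types (a b : letter N) (v w : seq (letter N)) (q : gstate N).

Lemma tact_same (i : vertex G) (c : alphabet N i) q :
  tact (Tagged (alphabet N) c) q i = trans c (q i).
Proof. by rewrite /tact ffunE dfwith_in. Qed.

Lemma tact_other a q (j : vertex G) : tag a != j -> tact a q j = q j.
Proof. by move=> aj; rewrite /tact ffunE dfwith_out. Qed.

Lemma tactC a b q : tact a (tact b q) = tact b (tact a q).
Proof.
case: a b => i a [j b]; apply/ffunP => k.
have [eij|nij] := eqVneq i j.
  subst j; have [eik|nik] := eqVneq i k; last by rewrite !tact_other.
  by subst k; rewrite !tact_same transC.
have [eik|nik] := eqVneq i k.
  by subst k; rewrite tact_same [RHS]tact_other 1?eq_sym // tact_same tact_other 1?eq_sym.
rewrite (@tact_other (existT _ i a)) //.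
have [ejk|njk] := eqVneq j k; last by rewrite !tact_other.
by subst k; rewrite !tact_same tact_other.
Qed.

Lemma messageE a q b : message a q b = (\sum_(e : out_edge (tag a))
  wcount [seq Tagged (alphabet N) c | c <- msg e (q (tag a)) (tagged a)] b)%N.
Proof. by rewrite ffunE. Qed.

(** At distinct vertices neither letter changes the state read by the other; at a common vertex this
    is [msgC] summed over the outgoing edges. *)
Lemma messageC a b q d :
  (message a q d + message b (tact a q) d =
   message b q d + message a (tact b q) d)%N.
Proof.
case: a b => i a [j b]; rewrite !messageE /=.
have [eij|nij] := eqVneq i j; last first.
  by rewrite addnC !tact_other //= eq_sym.
subst j; rewrite -!big_split /=; apply: eq_bigr => e _.
rewrite !tact_same !ffunE -!count_cat -!map_cat.
by apply/permP/perm_map/msgC.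
Qed.

Lemma tact_word_cat v w q : tact_word (v ++ w) q = tact_word w (tact_word v q).
Proof. by elim: v q => //= a v IH q. Qed.

Lemma tact_word_tact a w q : tact_word w (tact a q) = tact a (tact_word w q).
Proof. by elim: w q => //= b w IH q; rewrite tactC IH. Qed.

Lemma tact_wordC v w q :
  tact_word v (tact_word w q) = tact_word w (tact_word v q).
Proof. by elim: v q => //= a v IH q; rewrite -IH -(tact_word_tact a w). Qed.

Lemma perm_tact_word v w q : perm_eq v w -> tact_word v q = tact_word w q.
Proof.
apply: (catCA_perm_subst (F := fun v => tact_word v q)) => s1 s2 s3.
by rewrite !tact_word_cat (tact_wordC s2).
Qed.

Lemma message_word_nil q d : message_word [::] q d = 0%N.
Proof. by rewrite /= ffunE. Qed.

Lemma message_word_cons a w q d :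
  message_word (a :: w) q d = (message a q d + message_word w (tact a q) d)%N.
Proof. by rewrite /= ffunE. Qed.

Lemma message_word_cat v w q d : (message_word (v ++ w) q d =
  message_word v q d + message_word w (tact_word v q) d)%N.
Proof.
elim: v q => [|a v IH] q; first by rewrite message_word_nil.
by rewrite cat_cons !message_word_cons IH addnA.
Qed.

(** Repeated use of [messageC] moves one letter to the front, which is what an induction on permuted
    words needs. *)
Lemma message_word_swap v a w q d :
  message_word (v ++ a :: w) q d = message_word (a :: v ++ w) q d.
Proof.
elim: v q => [//|b v IH] q.
by rewrite !cat_cons !message_word_cons IH !message_word_cons !addnA messageC tactC.
Qed.

Lemma perm_message_word v w q d :
  perm_eq v w -> message_word v q d = message_word w q d.
Proof.
elim: v w q => [|a v IH] w q; first by rewrite perm_sym => /perm_nilP ->.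
move=> vw; have := perm_mem vw a; rewrite mem_head => /esym aw.
case/splitPr: aw vw => w1 w2 vw.
rewrite message_word_swap !message_word_cons; congr addn; apply: IH.
by rewrite -(perm_cons a) (perm_trans vw) // perm_catC /= perm_cons perm_catC.
Qed.

Lemma wcount_cat v w a : wcount (v ++ w) a = (wcount v a + wcount w a)%N.
Proof. by rewrite !ffunE count_cat. Qed.

Lemma perm_word_of_wcount w : perm_eq (word_of (wcount w)) w.
Proof.
apply/allP => a _ /=; apply/eqP.
rewrite /word_of count_flatten -map_comp sumnE big_map big_enum /=.
rewrite (bigD1 a) //= count_nseq /= eqxx mul1n ffunE big1 ?addn0 //.
by move=> b ba; rewrite count_nseq /= (negbTE ba) mul0n.
Qed.

Definition word_pow w m := flatten (nseq m w).

Lemma tact_word_pow w m q : tact_word (word_pow w m) q = iter m (tact_word w) q.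
Proof. by elim: m q => //= m IH q; rewrite tact_word_cat IH -iterS iterSr. Qed.

Lemma fire_wordE w (c : configuration N) :
  fire_word w c = ([ffun b => c.1 b + (message_word w c.2 b)%:Z - (wcount w b)%:Z],
                   tact_word w c.2).
Proof.
elim: w c => [|a w IH] [x q] /=.
  by congr pair; apply/ffunP => b; rewrite !ffunE addr0 subr0.
rewrite IH /=; congr pair; apply/ffunP => b.
rewrite !ffunE /= !PoszD [b == a]eq_sym.
ring.
Qed.


End Words.

(** * Taboo probabilities, and the Green function as their series *)

Section Taboo.
Variables (R : realType) (A : finType) (p : A -> A -> R) (z a : A).

(** For a chain started at [b], the probability of being at [a] at time [n] with [z] avoided at all
    times up to and including [n], computed by conditioning on the first step. *)
Fixpoint taboo (n : nat) (b : A) : R :=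
  (b != z)%:R * (if n is m.+1 then \sum_c p b c * taboo m c else (b == a)%:R).

(** The starting time [k] is a parameter so that an induction on [n] can move it forward one step at
    a time. *)
Definition tail_event (b : A) (X : markov_chain p b) (k n : nat) : set (mc_space X) :=
  [set omega | mc_proc X (k + n) omega = a /\
     forall m, (m <= n)%N -> mc_proc X (k + m) omega <> z].

Definition cylinder (b : A) (X : markov_chain p b) (k : nat) (x : nat -> A)
  : set (mc_space X) := [set omega | forall i, (i <= k)%N -> mc_proc X i omega = x i].

Section Chain.
Local Open Scope classical_set_scope.
Variables (b : A) (X : markov_chain p b).
Local Notation mu := (mc_law X).
Local Notation E := (@tail_event b X).
Local Notation C := (@cylinder b X).

Lemma measurable_cylinder k x : measurable (C k x).
Proof.
have -> : C k x = \bigcap_(i in `I_k.+1) [set omega | mc_proc X i omega = x i].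
  by apply/seteqP; split=> omega /= H i /H.
by apply: bigcap_measurableType => // i _; exact: mc_measurable.
Qed.

Lemma measurable_tail_event k n : measurable (E k n).
Proof.
have -> : E k n = [set omega | mc_proc X (k + n) omega = a] `&`
    \bigcap_(m in `I_n.+1) ~` [set omega | mc_proc X (k + m) omega = z].
  by apply/seteqP; split=> omega /= [? H]; split=> // m /H.
apply: measurableI; first exact: mc_measurable.
by apply: bigcap_measurableType => // i _; apply: measurableC; exact: mc_measurable.
Qed.

Lemma measure_split_state (k : nat) (B : set (mc_space X)) : measurable B ->
  mu B = (\sum_c mu (B `&` [set omega | mc_proc X k omega = c]))%E.
Proof.
move=> mB; have -> : (\sum_c mu (B `&` [set omega | mc_proc X k omega = c]))%E =
   (\sum_(c \in [set: A]) mu (B `&` [set omega | mc_proc X k omega = c]))%E.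
  rewrite fsbig_seq ?index_enum_uniq //.
  rewrite (_ : [set` _] = [set: A]) //.
  by apply/seteqP; split=> c //= _; rewrite mem_index_enum.
rewrite -measure_fin_bigcup //.
- congr (mu _); apply/seteqP; split=> omega /=; last by case=> c _ [].
  by move=> ?; exists (mc_proc X k omega).
- exact: finite_finset.
- by move=> c d _ _ [omega [[_ <-] [_ <-]]].
- by move=> c _; apply: measurableI => //; exact: mc_measurable.
Qed.

Definition extend (k : nat) (x : nat -> A) (c : A) (i : nat) := if i == k.+1 then c else x i.

Lemma extend_cylinder k x c :
  C k.+1 (extend k x c) = C k x `&` [set omega | mc_proc X k.+1 omega = c].
Proof.
apply/seteqP; split=> omega.
  move=> H; split=> [i ik|].
    by rewrite H ?(leq_trans ik) // /extend ltn_eqF.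
  by rewrite /= H // /extend eqxx.
move=> [H Hc] i; rewrite /extend leq_eqVlt.
have [->|_] := eqVneq i k.+1 => //= ik; exact: (H i ik).
Qed.

Lemma extend_law k x c :
  mu (C k.+1 (extend k x c)) = (mu (C k x) * (p (x k) c)%:E)%E.
Proof.
rewrite /cylinder !mc_cylinder -EFinM; congr EFin.
rewrite big_ord_recr /= mulrA /extend /= eqxx ltn_eqF //.
by congr (_ * _ * _); apply: eq_bigr => i _; rewrite eqSS !ltn_eqF // leqW.
Qed.

(** The Markov property, extracted from the cylinder law alone: the event is split by the state at
    time [k.+1], and each piece is a longer cylinder with a shorter tail. *)
Lemma cylinder_tail n k x :
  mu (C k x `&` E k n) = (mu (C k x) * (taboo n (x k))%:E)%E.
Proof.
elim: n k x => [|n IH] k x.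
  have [xz|xz] := eqVneq (x k) z; last have [xa|xa] := eqVneq (x k) a.
  - rewrite (_ : _ `&` _ = set0) ?measure0 /= ?xz ?eqxx ?mul0r ?mule0 //.
    rewrite -subset0 => omega [/(_ k (leqnn k)) H [_ /(_ 0%N isT)]].
    by rewrite addn0 H.
  - rewrite (_ : _ `&` _ = C k x) /= ?xa ?eqxx -?xa ?xz ?mulr1 ?mule1 //.
    apply/seteqP; split=> [omega []//|omega H]; split=> //.
    split; first by rewrite addn0 H.
    move=> [|//] _; rewrite addn0 H //; exact/eqP.
  - rewrite (_ : _ `&` _ = set0) ?measure0 /= ?(negbTE xa) ?mulr0 ?mule0 //.
    rewrite -subset0 => omega [/(_ k (leqnn k)) H []].
    by rewrite addn0 H => /eqP; rewrite (negbTE xa).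
have [xz|xz] := eqVneq (x k) z.
  rewrite (_ : _ `&` _ = set0) ?measure0 /= ?xz ?eqxx ?mul0r ?mule0 //.
  rewrite -subset0 => omega [/(_ k (leqnn k)) H [_ /(_ 0%N isT)]].
  by rewrite addn0 H.
rewrite (measure_split_state k.+1); last first.
  by apply: measurableI; [exact: measurable_cylinder|exact: measurable_tail_event].
(* Time [k] imposes no condition here because [x k != z], so the window of length [n.+1] from [k]
   becomes one of length [n] from [k.+1]. *)
have step c : C k x `&` E k n.+1 `&` [set omega | mc_proc X k.+1 omega = c] =
    C k.+1 (extend k x c) `&` E k.+1 n.
  rewrite extend_cylinder; apply/seteqP; split=> omega.
    move=> [[H [Ha Hz]] Hc]; split=> //; split; first by rewrite addSnnS.
    by move=> m mn; rewrite addSnnS; exact: Hz.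
  move=> [[H Hc] [Ha Hz]]; split=> //; split=> //; split; first by rewrite -addSnnS.
  move=> [_|m mn]; last by rewrite -addSnnS; exact: Hz.
  by rewrite addn0 H //; exact/eqP.
under eq_bigr => c _ do rewrite step IH extend_law /extend eqxx.
rewrite /cylinder !mc_cylinder /= xz mul1r.
under eq_bigr => c _ do rewrite -!EFinM -mulrA.
by rewrite sumEFin -EFinM mulr_sumr.
Qed.

Lemma tail_law n : mu (E 0%N n) = (taboo n b)%:E.
Proof.
rewrite (measure_split_state 0%N); last exact: measurable_tail_event.
have step c : E 0%N n `&` [set omega | mc_proc X 0%N omega = c] =
    C 0%N (fun=> c) `&` E 0%N n.
  rewrite setIC; congr (_ `&` _); apply/seteqP; split=> omega /=.
    by move=> H i; rewrite leqn0 => /eqP ->.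
  by apply.
under eq_bigr => c _ do rewrite step cylinder_tail /cylinder mc_cylinder big_ord0 mulr1 -EFinM.
rewrite sumEFin (bigD1 b) //= eqxx mul1r big1 ?addr0 // => c cb.
by rewrite (negbTE cb) mul0r.
Qed.

End Chain.

(** The integrand is a series of indicators of the events [tail_event 0 n], and nonnegativity allows
    termwise integration. *)
Lemma integral_visits (X : forall b, markov_chain p b) b :
  (\int[mc_law (X b)]_omega @visits_before _ _ _ X z a b omega =
   \sum_(0 <= n <oo) (taboo n b)%:E)%E.
Proof.
rewrite /visits_before integral_nneseries //.
- apply: eq_eseriesr => n _; rewrite -(tail_law (X b) n).
  by rewrite -[tail_event _ _]setIT -integral_indic //; exact: measurable_tail_event.
- move=> n; apply/measurable_EFinP.
  exact: measurable_indic (measurable_tail_event (X b) 0%N n).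
Qed.

End Taboo.

(** * The action on locally recurrent states, and the production matrix on loops *)

Section Recurrence.
Variables (G : digraph) (N : finite_abelian_network G).
Implicit Types (a b : letter N) (v w : seq (letter N)) (q : gstate N).

Lemma idempotent_product_tact w q :
  idempotent_product (tact_word w q) = tact_word w (idempotent_product q).
Proof.
rewrite /idempotent_product.
elim/big_rec: _ => [//|f g /asboolP[[v fE] _] IH] /=.
by rewrite IH !fE tact_wordC.
Qed.

(** The action of [w] is itself a factor of the product, and by commutativity it can be moved to
    that factor and absorbed. *)
Lemma idempotent_product_id w q :
  (forall q0, tact_word w (tact_word w q0) = tact_word w q0) ->
  tact_word w (idempotent_product q) = idempotent_product q.
Proof.
move=> idw; pose f : {ffun gstate N -> gstate N} := [ffun q => tact_word w q].
have fin : f \in index_enum {ffun gstate N -> gstate N} by rewrite mem_index_enum.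
have fid : monoid_idempotent f.
  by split; [exists w => q0|move=> q0]; rewrite !ffunE.
rewrite /idempotent_product; elim: (index_enum _) fin => //= h l IH.
rewrite inE big_cons; case: asboolP => [[[v hE] _]|nh].
  case/orP => [/eqP <-|/IH wl] /=; first by rewrite !ffunE idw.
  by rewrite !hE tact_wordC wl.
by case/orP => [/eqP hf|//]; case: nh; rewrite -hf.
Qed.

Lemma locally_recurrent_tact w q :
  locally_recurrent q -> locally_recurrent (tact_word w q).
Proof.
by case=> q0 ->; exists (tact_word w q0); rewrite idempotent_product_tact.
Qed.

(** Some power of the action of [w] is idempotent, hence is the identity on Loc(N); so every word
    permutes Loc(N) with finite order. *)
Lemma recurrent_power w : exists2 m, (0 < m)%N &
  forall q, locally_recurrent q -> iter m (tact_word w) q = q.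
Proof.
have [m m0 idm] := exists_idempotent_iter (tact_word w).
exists m => // q [q0 ->]; rewrite -tact_word_pow; apply: idempotent_product_id.
by move=> q1; rewrite !tact_word_pow.
Qed.

Lemma tact_word_inj w q q' : locally_recurrent q -> locally_recurrent q' ->
  tact_word w q = tact_word w q' -> q = q'.
Proof.
move=> rq rq' e; have [[//|m] _ fixm] := recurrent_power w.
by rewrite -(fixm q) // -(fixm q') // !iterSr e.
Qed.

(* On Loc(N) the transition monoid acts as a commutative transitive group, so an
   element with one fixed point is the identity. *)
Lemma tact_word_fix w q q' : locally_irreducible N ->
  locally_recurrent q -> locally_recurrent q' ->
  tact_word w q = q -> tact_word w q' = q'.
Proof.
move=> irr rq rq' fq; have [v [v' e]] := irr q q'.
apply: (@tact_word_inj v') => //; first exact: locally_recurrent_tact.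
by rewrite tact_wordC -e -tact_wordC fq.
Qed.

(** By [tact_word_fix] a loop at one recurrent state is a loop at all of them. The negative part of
    a count vector vanishes, so it is the count of the empty word. *)
Lemma total_kernel_wcount w q : locally_irreducible N ->
  locally_recurrent q -> tact_word w q = q ->
  total_kernel (int_of_vec (wcount w)).
Proof.
move=> irr rq fq q' rq'.
have -> : pos_part (int_of_vec (wcount w)) = wcount w.
  by apply/ffunP => a; rewrite !ffunE.
have -> : neg_part (int_of_vec (wcount w)) = wcount [::].
  apply/ffunP => a; rewrite !ffunE /=.
  by rewrite (@max_r _ _ _ 0) // oppr_le0.
rewrite /tact_vec (perm_tact_word q' (perm_word_of_wcount w)).
rewrite (perm_tact_word q' (perm_word_of_wcount [::])) /=.
exact: tact_word_fix fq.
Qed.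

Variable P : letter N -> letter N -> rat.
Hypotheses (irr : locally_irreducible N) (prodP : production_matrix P).

Lemma production_loop w q a : locally_recurrent q -> tact_word w q = q ->
  \sum_b P a b * (wcount w b)%:R = (message_word w q a)%:R.
Proof.
move=> rq fq; rewrite (prodP (total_kernel_wcount irr rq fq) rq).
by rewrite /message_vec (perm_message_word _ _ (perm_word_of_wcount w)).
Qed.

(** Some power of the one-letter word [b] is a loop at [q]; its counts are supported at [b], so
    [P a b] times a positive integer is a message count. *)
Lemma production_matrix_ge0 q a b : locally_recurrent q -> 0 <= P a b.
Proof.
move=> rq; have [m m0 fixm] := recurrent_power [:: b].
have fq : tact_word (word_pow [:: b] m) q = q by rewrite tact_word_pow fixm.
have := production_loop a rq fq; rewrite (bigD1 b) //= big1 => [|c cb].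
  rewrite addr0 => e.
  suff : 0 <= P a b * (wcount (word_pow [:: b] m) b)%:R.
    rewrite pmulr_lge0 // ltr0n ffunE /word_pow count_flatten map_nseq /= eqxx.
    by rewrite sumn_nseq addn0 mul1n.
  by rewrite e ler0n.
rewrite ffunE /word_pow count_flatten map_nseq /= eq_sym (negbTE cb).
by rewrite sumn_nseq mul0n mulr0.
Qed.

(** The word [w ++ u] is a loop at [q], so [production_loop] gives P(|w| + |u|) = M_w(q) + M_u(q');
    the firing rule x' = x + M_w(q) - |w| eliminates M_w(q). *)
Lemma legal_execution_balance (x x' : {ffun letter N -> int}) q q' w u b :
  locally_recurrent q -> fire_word w (x, q) = (x', q') -> tact_word u q' = q ->
  (wcount w b)%:R - \sum_d P b d * (wcount w d)%:R =
  (x b - x' b)%:~R + (\sum_d P b d * (wcount u d)%:R - (message_word u q' b)%:R).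
Proof.
move=> rq; rewrite fire_wordE => -[xE <-]; rewrite -tact_word_cat => uq.
have -> : x' b = x b + (message_word w q b)%:Z - (wcount w b)%:Z.
  by rewrite -xE [LHS]ffunE.
have := production_loop b rq uq.
under eq_bigr => d _ do rewrite wcount_cat natrD mulrDr.
rewrite big_split /= message_word_cat natrD => /eqP.
rewrite -subr_eq0 => /eqP e; apply/eqP; rewrite -subr_eq0; apply/eqP.
rewrite rmorphB rmorphB rmorphD /= -!pmulrn -[RHS]oppr0 -[in RHS]e.
ring.
Qed.

End Recurrence.

(** * Finiteness of the Green function and its first-step equation *)

Section Green.
Local Open Scope classical_set_scope.
Variables (R : realType) (A : finType) (p : A -> A -> R) (pi : A -> R) (z a : A).
Hypothesis p_ge0 : forall b c, 0 <= p b c.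
Hypothesis pi_gt0 : forall b, 0 < pi b.
Hypothesis pi_stationary : forall c, \sum_b pi b * p b c = pi c.
Hypothesis irreducible : forall c, connect (fun b c => 0 < p b c) z c.

(** Partial sums of the Green series: expected visits to [a] before hitting [z], at times below
    [n]. *)
Let S n b : R := \sum_(0 <= i < n) taboo p z a i b.

Lemma taboo_ge0 n b : 0 <= taboo p z a n b.
Proof.
elim: n b => [|n IH] b /=; first by rewrite mulr_ge0.
by rewrite mulr_ge0 // sumr_ge0 // => c _; rewrite mulr_ge0.
Qed.

Let S_rec n b :
  S n.+1 b = (b != z)%:R * ((b == a)%:R + \sum_c p b c * S n c).
Proof.
rewrite /S big_nat_recl //= -mulr_sumr -mulrDr; congr (_ * (_ + _)).
rewrite exchange_big /=; apply: eq_bigr => c _; exact/esym/mulr_sumr.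
Qed.

Let S_ge0 n b : 0 <= S n b.
Proof. by apply: sumr_ge0 => i _; exact: taboo_ge0. Qed.

Let S_mono n b : S n b <= S n.+1 b.
Proof. by rewrite /S big_nat_recr //= lerDl taboo_ge0. Qed.

Let S_zero n : S n z = 0.
Proof. by apply: big1 => -[|i] _; rewrite /= eqxx mul0r. Qed.

(* Pair [S n <= S n.+1] with the stationary vector: everything cancels except
   the flow out of z, which the recursion does not see. *)
Let S_return n : pi z * \sum_c p z c * S n c <= pi a.
Proof.
have : \sum_b pi b * S n b <= \sum_b pi b * S n.+1 b.
  by apply: ler_sum => b _; rewrite ler_pM2l.
have E : \sum_b pi b * \sum_c p b c * S n c = \sum_b pi b * S n b.
  under eq_bigr => b _ do rewrite mulr_sumr.
  rewrite exchange_big /=; apply: eq_bigr => c _.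
  by rewrite -pi_stationary mulr_suml; apply: eq_bigr => b _; rewrite mulrA.
rewrite -E (bigD1 z) //= [leRHS](bigD1 z) //= S_zero mulr0 add0r => H.
rewrite -(lerD2r (\sum_(i | i != z) pi i * \sum_c p i c * S n c)).
apply: (le_trans H).
under eq_bigr => b bz do rewrite S_rec bz mul1r mulrDr.
rewrite big_split /= lerD2r.
apply: (@le_trans _ _ (\sum_b pi b * (b == a)%:R)).
  by rewrite [leRHS](bigD1 z) //= lerDr mulr_ge0 // ltW.
by rewrite (bigD1 a) //= eqxx mulr1 big1 ?addr0 // => b /negbTE ->; rewrite mulr0.
Qed.

(* [S_return] bounds S at the successors of z, and [S n.+1 b >= p b c * S n c]
   carries the bound along every path. *)
Let S_bounded c : exists M, forall n, S n c <= M.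
Proof.
have /connectP [l zl ->] := irreducible c; elim/last_ind: l zl => [|l d IH] /=.
  by move=> _; exists 0 => n; rewrite S_zero.
rewrite rcons_path last_rcons => /andP[/IH [M HM]]; set b := last z l in HM * => pbd.
have le n : p b d * S n d <= \sum_c p b c * S n c.
  by rewrite (bigD1 d) //= lerDl sumr_ge0 // => c' _; rewrite mulr_ge0.
have [bz|bz] := eqVneq b z.
  exists (pi a / pi z / p b d) => n.
  rewrite !ler_pdivlMr // mulrC [S n d * _]mulrC.
  by apply: le_trans (S_return n); rewrite ler_pM2l // -bz.
exists (M / p b d) => n; rewrite ler_pdivlMr // mulrC.
apply: le_trans (le n) (le_trans _ (HM n.+1)).
by rewrite S_rec bz mul1r lerDr.
Qed.

Variable X : forall b : A, markov_chain p b.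

(** The partial sums are monotone and bounded, so the integral is finite and [fine] in [green]
    returns its true value. *)
Lemma green_cvg b : S ^~ b @ \oo --> green X z b a.
Proof.
have cS : cvgn (S ^~ b).
  apply: nondecreasing_is_cvgn; first by apply/nondecreasing_seqP => n; exact: S_mono.
  by have [M HM] := S_bounded b; exists M => _ [n _ <-].
suff -> : green X z b a = limn (S ^~ b) by [].
rewrite /green integral_visits -[RHS]/(fine (limn (S ^~ b))%:E) -EFin_lim //.
congr (fine (limn _)); apply/funext => n /=.
by rewrite sumEFin.
Qed.

(** Both sides of [S_rec] are passed to the limit. *)
Lemma green_first_step b : green X z b a =
  (b != z)%:R * ((b == a)%:R + \sum_c p b c * green X z c a).
Proof.
have c1 : S n.+1 b @[n --> \oo] --> green X z b a.
  by have := @green_cvg b; rewrite -cvg_shiftS.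
rewrite (funext (S_rec ^~ b)) in c1.
apply: (cvg_unique _ c1); first exact: norm_hausdorff.
apply: cvgMl_tmp; apply: cvgD; first exact: cvg_cst.
apply: cvg_big => [|c _]; first exact: add_continuous.
apply: cvgMl_tmp; exact: green_cvg.
Qed.

End Green.

(** * The potential vectors v_{a,z} and the value of c *)

Section Potential.
Variables (R : realType) (G : digraph) (N : finite_abelian_network G).
Variables (P : letter N -> letter N -> rat) (r s : {ffun letter N -> nat}).
Variable X : forall b : letter N, markov_chain (chain_matrix R P s) b.
Hypotheses (P_ge0 : forall a b, 0 <= P a b) (P_conn : strongly_connected P).
Hypotheses (r_gt0 : forall a, (0 < r a)%N) (s_gt0 : forall a, (0 < s a)%N).
Hypothesis r_fix : forall a, \sum_b P a b * (r b)%:R = (r a)%:R.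

Let r0 a : 0 < (r a)%:R :> R. Proof. by rewrite ltr0n. Qed.
Let s0 a : 0 < (s a)%:R :> R. Proof. by rewrite ltr0n. Qed.
Let s_neq0 a : (s a)%:R != 0 :> R. Proof. exact: lt0r_neq0. Qed.

Let r_fixR a : \sum_b (ratr (P a b) : R) * (r b)%:R = (r a)%:R.
Proof.
rewrite -[RHS](ratr_nat R) -r_fix rmorph_sum /=.
by apply: eq_bigr => b _; rewrite rmorphM /= ratr_nat.
Qed.

Lemma chain_matrix_gt0 a b : (0 < chain_matrix R P s a b) = (0 < P b a).
Proof. by rewrite /chain_matrix pmulr_rgt0 ?ltr0q // divr_gt0. Qed.

Lemma chain_green_first_step z a b : green X z b a =
  (b != z)%:R * ((b == a)%:R + \sum_c chain_matrix R P s b c * green X z c a).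
Proof.
(* The stationary vector is s(b) r(b): s(b) r(b) p(b,c) = s(c) P(c,b) r(b), and summing over b with
   P r = r gives s(c) r(c). *)
apply: (@green_first_step _ _ _ (fun b => (s b)%:R * (r b)%:R)).
- by move=> c d; apply: mulr_ge0; [exact: divr_ge0|rewrite ler0q].
- by move=> c; rewrite mulr_gt0.
- move=> c; rewrite -[in RHS]r_fixR mulr_sumr; apply: eq_bigr => d _.
  by rewrite /chain_matrix; field.
- move=> c; rewrite (eq_connect (e' := fun a b => 0 < P b a)) //.
  by move=> d e; rewrite chain_matrix_gt0.
Qed.

(* v_{a,z}^T (I - P) is the indicator of a off z; its entry at z is then forced
   by (I - P) r = 0. *)
Lemma vpot_balance a z (n : letter N -> R) :
  \sum_b vpot X a z b * (n b - \sum_d ratr (P b d) * n d) =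
  n a - (r a)%:R / (r z)%:R * n z.
Proof.
pose v := vpot X a z.
pose c d := v d - \sum_b v b * ratr (P b d).
have colE (m : letter N -> R) :
    \sum_b v b * (m b - \sum_d ratr (P b d) * m d) = \sum_d c d * m d.
  under eq_bigr => b _ do rewrite mulrBr mulr_sumr.
  rewrite sumrB exchange_big /= -sumrB; apply: eq_bigr => d _.
  rewrite mulrBl mulr_suml; congr (_ - _); apply: eq_bigr => b _.
  by rewrite mulrA.
have c_off d : d != z -> c d = (d == a)%:R.
  move=> dz; rewrite /c /v /vpot chain_green_first_step dz mul1r mulrDr.
  rewrite mulr_sumr -addrA -sumrB big1 ?addr0 => [|b _].
    by have [->|_] := eqVneq d a; rewrite ?mulr0 // mulr1 divff.
  rewrite /chain_matrix; field.
  by rewrite !s_neq0.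
have split (m : letter N -> R) : \sum_d c d * m d = c z * m z + (a != z)%:R * m a.
  rewrite (bigD1 z) //=; congr (_ + _).
  under eq_bigr => d dz do rewrite c_off //.
  have [->|az] := eqVneq a z.
    by rewrite mul0r big1 // => d /negbTE ->; rewrite mul0r.
  rewrite (bigD1 a) //= eqxx big1 ?addr0 // => d /andP[_ /negbTE ->].
  by rewrite mul0r.
have : c z * (r z)%:R + (a != z)%:R * (r a)%:R = 0.
  rewrite -(split (fun d => (r d)%:R)) -colE big1 // => b _.
  by rewrite r_fixR subrr mulr0.
rewrite colE split => /eqP; rewrite addr_eq0 => /eqP cz.
have -> : c z = - ((a != z)%:R * (r a)%:R) / (r z)%:R.
  by rewrite -cz mulfK // lt0r_neq0.
have [->|az] := eqVneq a z; first by rewrite divff ?lt0r_neq0 // /=; ring.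
by rewrite /=; ring.
Qed.

(** The quantity maximized over z is n(a) - r(a) n(z)/r(z), so a minimizer of n(z)/r(z) is optimal
    for every [a] at once, and m is that minimum. The premise [letter N] provides a point for the
    minimum to range over. *)
Lemma cbound_ratio (x x' : {ffun letter N -> int}) (q' : gstate N)
    (u : seq (letter N)) (n : letter N -> R) :
  (forall b, n b - \sum_d ratr (P b d) * n d = (x b - x' b)%:~R +
     (\sum_d ratr (P b d) * (wcount u d)%:R - (message_word u q' b)%:R)) ->
  letter N ->
  exists m : R, forall a,
    cbound X x x' q' u a = n a - m * (r a)%:R /\ 0 <= n a - m * (r a)%:R.
Proof.
move=> bal a0.
have FE a z : \sum_b vpot X a z b * (x b - x' b)%:~R + Defs.diff X a z q' u =
    n a - n z / (r z)%:R * (r a)%:R.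
  transitivity (n a - (r a)%:R / (r z)%:R * n z); last by ring.
  rewrite -vpot_balance -big_split /=; apply: eq_bigr => b _.
  by rewrite bal -mulrDr.
have [z _ zmin] := arg_minP (fun z => n z / (r z)%:R) (erefl : predT a0).
exists (n z / (r z)%:R) => a; split; last first.
  by rewrite subr_ge0 -ler_pdivlMr // zmin.
apply/eqP; rewrite eq_le; apply/andP; split; last first.
  by rewrite -FE; exact: (le_bigmax _ _ z).
by apply: bigmax_le => [|d _]; rewrite FE lerD2l lerN2 ler_pM2r // zmin.
Qed.

End Potential.

(** * Word length, and the discrepancy bounds *)

Lemma size_sum_wcount (G : digraph) (N : finite_abelian_network G)
  (w : seq (letter N)) : (size w = \sum_a wcount w a)%N.
Proof.
elim: w => [|a w IH] /=; first by rewrite big1 // => a _; rewrite ffunE.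
rewrite (eq_bigr (fun b => (a == b) + wcount w b)%N) => [|b _]; last by rewrite !ffunE.
rewrite big_split /= -IH (bigD1 a) //= eqxx big1 ?addn0 ?add1n // => b.
by rewrite eq_sym => /negbTE ->.
Qed.

Unset Implicit Arguments.
Set Strict Implicit.
Set Printing Implicit Defensive.

Theorem theorem6p9 (R : realType) (G : digraph) (N : finite_abelian_network G)
    (P : letter N -> letter N -> rat) (r s : {ffun letter N -> nat})
    (X : forall b : letter N, markov_chain (chain_matrix R P s) b)
    (q q' : gstate N) (x x' : {ffun letter N -> int}) (w u : seq (letter N)) :
  locally_irreducible N ->
  production_matrix P ->
  strongly_connected P ->
  critical P ->
  period_vector P r ->
  exchange_rate_vector P s ->
  locally_recurrent q ->
  locally_recurrent q' ->
  legal w (x, q) ->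
  fire_word w (x, q) = (x', q') ->
  tact_word u q' = q ->
  let c (a : letter N) : R := cbound X x x' q' u a in
  let normc : R := \sum_a c a in
  let normr : R := (\sum_a r a)%N%:R in
  forall a : letter N,
    - (normc / normr * (r a)%:R) - (r a)%:R
      < (wcount w a)%:R - (size w)%:R / normr * (r a)%:R
    /\ (wcount w a)%:R - (size w)%:R / normr * (r a)%:R
      < (r a)%:R + c a.
Proof.
move=> irr prodP conn _ [r_gt0 r_gen] [s_gt0 _ _] rq _ _ wE uE c normc normr a.
have r_fix b : \sum_d P b d * (r d)%:R = (r b)%:R.
  pose rz : {ffun letter N -> int} := [ffun d => (r d)%:Z].
  (* The vector r is the multiple of itself by 1, hence belongs to the group it generates and is
     fixed by P. *)
  have [|_ fixr] := (r_gen rz).2 _; first by exists 1 => d; rewrite ffunE mul1r.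
  transitivity ((rz b)%:~R : rat); last by rewrite ffunE.
  by rewrite -fixr; apply: eq_bigr => d _; rewrite ffunE.
have bal b : ((wcount w b)%:R : R) - \sum_d ratr (P b d) * (wcount w d)%:R =
    (x b - x' b)%:~R +
    (\sum_d ratr (P b d) * (wcount u d)%:R - (message_word u q' b)%:R).
  have ratP (n : letter N -> nat) : \sum_d (ratr (P b d) : R) * (n d)%:R =
      ratr (\sum_d P b d * (n d)%:R).
    by rewrite rmorph_sum; apply: eq_bigr => d _; rewrite rmorphM /= ratr_nat.
  have := congr1 (@ratr R) (legal_execution_balance irr prodP b rq wE uE).
  rewrite [LHS]rmorphB rmorphD /= ratr_int [ratr (_ - (message_word _ _ _)%:R)]rmorphB.
  by rewrite /= !ratr_nat !ratP.
have [m cE] := cbound_ratio X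
  (fun b d => production_matrix_ge0 irr prodP b d rq) conn r_gt0 s_gt0 r_fix bal a.
have normr_gt0 : 0 < normr.
  by rewrite /normr (bigD1 a) //= natrD ltr_pwDl // ?ltr0n // ler0n.
(* This is |w| = m r + c summed over all letters. *)
have sizeE : (size w)%:R = normc + m * normr.
  rewrite size_sum_wcount /normr /normc !natr_sum mulr_sumr -big_split /=.
  by apply: eq_bigr => b _; rewrite /c (cE b).1 subrK.
have -> : (size w)%:R / normr * (r a)%:R = normc / normr * (r a)%:R + m * (r a)%:R.
  by rewrite sizeE; field; exact: lt0r_neq0.
have ra0 : 0 < (r a)%:R :> R by rewrite ltr0n.
have normc_ge0 : 0 <= normc / normr * (r a)%:R.
  rewrite mulr_ge0 ?divr_ge0 ?(ltW normr_gt0) ?(ltW ra0) //.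
  by apply: sumr_ge0 => b _; rewrite /c (cE b).1 (cE b).2.
(* The middle quantity is now c(a) - (||c||/||r||) r(a), a difference of two nonnegative terms; the
   extra r(a) > 0 makes both bounds strict. *)
have [ca ca0] := cE a; rewrite [c a]ca.
by split; lra.
Qed.
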